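(* Let $f\colon \mathbb{N}\to\mathbb{R}^{\geq 0}$ be the function defined in the context. Then $\sup_{i\geq 0} f(i) = 1+\sum_{n=1}^\infty \frac{1}{F_{2n}}$ (in particular, this series converges).
   Context: $\mathbb{N}=\{0,1,2,\dots\}$. Let $F_n$ denote the Fibonacci numbers, $F_0=0$, $F_1=1$, $F_n=F_{n-1}+F_{n-2}$ for $n>1$, and let $u_i=F_{2i}$ for $i\geq 1$. Every $N\in\mathbb{N}$ has a unique representation $N=\sum_{i=1}^\infty d_iu_i$ with digits $d_i\in\{0,1,2\}$, only finitely many nonzero, such that whenever $i<j$ and $d_i=d_j=2$ there exists $l$ with $i<l<j$ and $d_l=0$. For $a\in\mathbb{N}$ write $d^a_i$ for the digits of this representation of $a$, and define $f(a)=\sum_{i=1}^\infty \frac{d^a_i}{u_i}$. *)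

(* Defs.v *)
From mathcomp Require Import all_boot all_order all_algebra.
From mathcomp Require Import all_classical all_reals all_analysis.
From mathcomp Require Import zify.

Set Implicit Arguments.
Unset Strict Implicit.
Unset Printing Implicit Defensive.

Import Order.TTheory GRing.Theory Num.Theory.
Import numFieldNormedType.Exports.

Local Open Scope classical_set_scope.
Local Open Scope ring_scope.

Fixpoint fib (n : nat) : nat :=
  match n with
  | 0 => 0
  | m.+1 => match m with 0 => 1 | k.+1 => fib m + fib k end
  end%N.

Definition u (i : nat) : nat := fib (2 * i)%N.

(* Digits are indexed from 1; the unused [d 0] is fixed to 0 so that a
   representation is unique as a function on nat.  Since all digits from
   index [m] on vanish, the sum below [m] is the whole sum over [i >= 1]. *)
Definition is_repr (a : nat) (d : nat -> nat) : Prop :=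
  [/\ d 0 = 0,
      (forall i, d i <= 2),
      (exists m, (forall i, m <= i -> d i = 0) /\
                 a = \sum_(1 <= i < m) d i * u i)
    & forall i j, i < j -> d i = 2 -> d j = 2 ->
        exists l, [/\ i < l, l < j & d l = 0]]%N.

Section ReprExistsUnique.
Local Open Scope nat_scope.

Lemma u0 : u 0 = 0. Proof. by []. Qed.
Lemma u1 : u 1 = 1. Proof. by []. Qed.
Lemma uSS n : u n.+2 + u n = 3 * u n.+1.
Proof.
rewrite /u; have -> : 2 * n.+2 = (2 * n).+4 by lia.
have -> : 2 * n.+1 = (2 * n).+2 by lia.
by move: (2 * n) => k /=; lia.
Qed.

Lemma u_lt n : u n < u n.+1.
Proof. by elim: n => [//|n IH]; have := uSS n; lia. Qed.

Lemma u_ge n : n <= u n.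
Proof. by elim: n => [//|n IH]; have := u_lt n; lia. Qed.

Local Definition dsum (n : nat) (d : nat -> nat) := \sum_(1 <= i < n.+1) d i * u i.

Local Definition adm (n : nat) (d : nat -> nat) : Prop := (forall i, d i <= 2) /\
  forall i j, 0 < i -> i < j -> j <= n -> d i = 2 -> d j = 2 ->
    exists l, [/\ i < l, l < j & d l = 0].

Local Definition capped (n : nat) (d : nat -> nat) : Prop := forall i, 0 < i -> i <= n -> d i = 2 ->
  exists l, [/\ i < l, l <= n & d l = 0].

Local Lemma dsum0 d : dsum 0 d = 0. Proof. by rewrite /dsum big_geq. Qed.

Local Lemma dsumS n d : dsum n.+1 d = dsum n d + d n.+1 * u n.+1.
Proof. by rewrite /dsum big_nat_recr. Qed.

Local Lemma admS n d : adm n.+1 d -> adm n d.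
Proof.
by case=> d2 dV; split=> // i j i0 ij jn; apply: dV => //; apply: leqW.
Qed.

Local Lemma dsum_bound n d : adm n d -> dsum n d < u n.+1 /\ (capped n d -> dsum n d + u n < u n.+1).
Proof.
elim: n => [|n IH] Vd; first by rewrite dsum0.
have [A1 B1] := IH (admS Vd); rewrite dsumS; have un := uSS n.
have [d2 dV] := Vd; have := d2 n.+1.
have dB : d n.+1 = 1 -> capped n.+1 d -> capped n d.
  move=> d1 Bd i i0 lin di; have [l [il ln dl]] := Bd i i0 (leqW lin) di.
  exists l; split=> //; move: ln; rewrite leq_eqVlt => /orP[/eqP El|//].
  by rewrite El d1 in dl.
case E : (d n.+1) => [|[|[|//]]] _.
- have ul := u_lt n.
  split=> [|Bd]; lia.
- split=> [|Bd]; first by have := u_lt n; lia.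
  by have := B1 (dB E Bd); lia.
- have /B1 H : capped n d.
    move=> i i0 lin di; have [|l [il ln dl]] := dV i n.+1 i0 _ (leqnn _) di E.
      by rewrite ltnS.
    by exists l.
  split=> [|Bd]; first by lia.
  have [//|l [nl ln _]] := Bd n.+1 _ (leqnn _) E.
  by move: nl; rewrite ltnNge ln.
Qed.

Local Lemma dsum_inj n d e : adm n d -> adm n e -> dsum n d = dsum n e ->
  forall i, 0 < i <= n -> d i = e i.
Proof.
elim: n => [|n IH] Vd Ve; first by move=> _ i; lia.
rewrite !dsumS => E; have [ld _] := dsum_bound (admS Vd).
have [le _] := dsum_bound (admS Ve).
have En : d n.+1 = e n.+1 by nia.
move=> i /andP[i0]; rewrite leq_eqVlt => /orP[/eqP->//|lin].
by apply: (IH (admS Vd) (admS Ve)); [rewrite En in E; lia|rewrite i0].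
Qed.

Local Definition ext (n c : nat) (d : nat -> nat) (i : nat) : nat := if i == n.+1 then c else d i.

Local Lemma dsum_ext n c d : dsum n.+1 (ext n c d) = dsum n d + c * u n.+1.
Proof.
rewrite dsumS {2}/ext eqxx; congr (_ + _); apply: eq_big_nat => i Hi.
by rewrite /ext ifF //; lia.
Qed.

Local Lemma adm_ext n c d : c <= 2 -> adm n d -> (c = 2 -> capped n d) -> adm n.+1 (ext n c d).
Proof.
move=> c2 [d2 dV] cB; split=> [i|i j i0 ij jn]; first by rewrite /ext; case: ifP.
rewrite /ext (_ : (i == n.+1) = false); last by lia.
move=> di; case: ifP => [/eqP jE /cB Bd|jE dj].
  have [|l [il ln dl]] := Bd i i0 _ di; first by lia.
  by exists l; rewrite ifF //; [split=> //|]; lia.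
have [|l [il lj dl]] := dV i j i0 ij _ di dj; first by lia.
by exists l; rewrite ifF //; lia.
Qed.

Local Lemma repr_ex n a : a < u n.+1 -> exists d,
  [/\ adm n d, dsum n d = a, (forall i, ~~ (0 < i <= n) -> d i = 0)
    & (a + u n < u n.+1 -> capped n d)].
Proof.
elim: n a => [|n IH] a Ha.
  exists (fun=> 0); split=> //.
  - by rewrite dsum0; move: Ha; rewrite u1; lia.
have un := uSS n; have ul := u_lt n.
have exP c d : (forall i, ~~ (0 < i <= n) -> d i = 0) ->
    forall i, ~~ (0 < i <= n.+1) -> ext n c d i = 0.
  by move=> d0 i Hi; rewrite /ext ifF; [apply: d0|]; lia.
have [a1|a1] := ltnP a (u n.+1).
  have [d [Vd Sd d0 _]] := IH a a1; exists (ext n 0 d); split.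
  - exact: adm_ext.
  - by rewrite dsum_ext Sd; lia.
  - exact: exP.
  - move=> _ i i0 lin; rewrite /ext; case: ifP => // iE _.
    by exists n.+1; rewrite eqxx; split=> //; lia.
have [a2|a2] := ltnP a (2 * u n.+1).
  have [|d [Vd Sd d0 Bd]] := IH (a - u n.+1); first by lia.
  exists (ext n 1 d); split.
  - exact: adm_ext.
  - by rewrite dsum_ext Sd; lia.
  - exact: exP.
  - move=> H i i0 lin; rewrite /ext; case: ifP => // iE di.
    have [||l [il ln dl]] := Bd _ i i0 _ di; [lia|lia|].
    by exists l; rewrite ifF; [split=> //|]; lia.
have [|d [Vd Sd d0 Bd]] := IH (a - 2 * u n.+1); first by lia.
exists (ext n 2 d); split.
- by apply: adm_ext => // _; apply: Bd; lia.
- by rewrite dsum_ext Sd; lia.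
- exact: exP.
- by lia.
Qed.

Lemma repr_exists a : exists d, is_repr a d.
Proof.
have [|d [[d2 dV] Sd d0 _]] := @repr_ex a a; first exact: u_ge.
exists d; split=> //; first by apply: d0.
  by exists a.+1; split=> // i Hi; apply: d0; lia.
move=> i j ij di dj.
have i0 : 0 < i by case: i di {ij} => // ; rewrite d0.
apply: (dV i j) => //; rewrite leqNgt; apply/negP => ja.
by rewrite d0 in dj; lia.
Qed.

Lemma repr_unique a d e : is_repr a d -> is_repr a e -> d = e.
Proof.
move=> [d0 d2 [m [dm ->]] dV] [e0 e2 [p [ep E]] eV].
have tail0 (q r : nat) (h : nat -> nat) : (forall i, q <= i -> h i = 0) ->
    q <= r -> dsum r h = \sum_(1 <= i < q) h i * u i.
  move=> hq qr; rewrite /dsum; have [q1|q1] := leqP q 1.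
    rewrite [RHS]big_geq // big_nat big1 // => i /andP[i1 _].
    by rewrite hq //; lia.
  rewrite (@big_cat_nat _ _ _ q) //=; [|lia|lia].
  rewrite [X in _ + X]big_nat [X in _ + X]big1 ?addn0 // => i /andP[qi _].
  by rewrite hq.
apply/funext => i; have [->|i0] := eqVneq i 0; first by rewrite d0.
apply: (@dsum_inj (m + p + i)).
- by split=> // k j _ kj _; exact: dV.
- by split=> // k j _ kj _; exact: eV.
- by rewrite (tail0 m) ?(tail0 p) //; lia.
- by lia.
Qed.

End ReprExistsUnique.

Definition digits (a : nat) : nat -> nat := projT1 (cid (repr_exists a)).

Lemma digitsP a : is_repr a (digits a).
Proof. exact: projT2 (cid (repr_exists a)). Qed.

(* A limit of eventually constant partial sums. *)
Definition f (R : realType) (a : nat) : R :=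
  limn (fun n => \sum_(1 <= i < n) (digits a i)%:R / (u i)%:R : R).

Lemma f_ge0 (R : realType) (a : nat) : 0 <= f R a.
Proof.
have [_ _ [m [dm _]] _] := digitsP a.
pose s := \sum_(1 <= i < m.+1) (digits a i)%:R / (u i)%:R : R.
have -> : f R a = s.
  apply/cvg_lim => //; apply: cvg_near_cst; near=> n.
  have mn : (m < n)%N by near: n; exists m.+1.
  rewrite (@big_cat_nat _ _ _ m.+1) //= [X in _ + X]big_nat [X in _ + X]big1 ?addr0 //.
  by move=> i /andP[mi _]; rewrite dm ?mul0r // ltnW.
by apply: sumr_ge0 => i _; rewrite divr_ge0 ?ler0n.
Unshelve. all: by end_near. Qed.

(* Main.v *)
(** Consecutive digits 2 are separated by a digit 0, so in the sum of
    [(d_i - 1) / u_i] the signs +1 and -1 alternate, starting at worst with +1.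
    As [1 / u_i] decreases, such an alternating sum is at most [1 / u_1 = 1];
    this is the upper bound. The digit strings 2,1,1,...,1 approach it. *)

Require Import Defs.
From mathcomp Require Import all_boot all_order all_algebra.
From mathcomp Require Import all_classical all_reals all_analysis.
From mathcomp Require Import zify lra.

Import Order.TTheory GRing.Theory Num.Theory.
Import numFieldNormedType.Exports.

Local Open Scope classical_set_scope.
Local Open Scope ring_scope.

(** Monotonicity of [w] is asked only from index 1 on: the weight [1 / u 0] is 0, since [u 0 = 0]
    and the inverse of 0 is 0. *)
Lemma sum_digits_le (R : realDomainType) (w : nat -> R) (d : nat -> nat) (n : nat) :
    (forall i, 0 <= w i) -> (forall i, (0 < i)%N -> w i.+1 <= w i) ->
    (forall i, d i <= 2)%N ->
    (forall i j, i < j -> d i = 2 -> d j = 2 ->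
      exists l, [/\ i < l, l < j & d l = 0])%N ->
  \sum_(1 <= i < n.+1) (d i)%:R * w i <= w 1%N + \sum_(1 <= i < n.+1) w i.
Proof.
move=> w0 wS d2 dV.
(* The second bound applies when a digit 2 in position [n + 1] is allowed. *)
suff /(_ n)[] : forall n,
    \sum_(1 <= i < n.+1) (d i)%:R * w i <= w 1%N + \sum_(1 <= i < n.+1) w i /\
    ((forall i, 0 < i <= n -> d i = 2 -> exists l, [/\ i < l, l <= n & d l = 0])%N ->
     \sum_(1 <= i < n.+1) (d i)%:R * w i <=
       w 1%N + \sum_(1 <= i < n.+1) w i - w n.+1) by [].
elim=> [|{}n [IH IHsep]]; first by rewrite !big_geq // addr0 subrr w0.
rewrite ![\sum_(1 <= i < n.+2) _]big_nat_recr //=.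
have wn1 := w0 n.+1; have wn2 := wS n.+1 isT.
have := d2 n.+1; case dn: (d n.+1) => [|[|[|//]]] _.
(* A digit 0 gains a slack of [w n.+1], which is at least [w n.+2]. *)
- by split=> [|_]; lra.
(* A digit 1 keeps the slack; no separating 0 sits at [n.+1], so [sep] descends to [n]. *)
- split=> [|sep]; first by lra.
  suff /IHsep : forall i, (0 < i <= n)%N -> d i = 2 ->
    exists l, [/\ i < l, l <= n & d l = 0]%N by lra.
  move=> i /andP[i0 lein] di.
  have [|l [il ln dl]] := sep i _ di; first by rewrite i0 leqW.
  exists l; split=> //; move: ln; rewrite leq_eqVlt => /orP[/eqP lE|//].
  by rewrite lE dn in dl.
(* A digit 2 uses up exactly the slack [w n.+1]; afterwards [sep] is contradictory, as no position
   lies strictly after [n.+1] and up to [n.+1]. *)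
- split=> [|sep].
    suff /IHsep : forall i, (0 < i <= n)%N -> d i = 2 ->
      exists l, [/\ i < l, l <= n & d l = 0]%N by lra.
    by move=> i /andP[_ lein] di; exact: (dV i n.+1).
  have [|l [nl ln _]] := sep n.+1 _ dn; first by rewrite ltnSn.
  by move: nl; rewrite ltnNge ln.
Qed.

Lemma u_gt0 n : (0 < n)%N -> (0 < u n)%N.
Proof. by move=> n0; exact: leq_trans n0 (u_ge n). Qed.

Section ReciprocalSeries.
Variable R : realType.

Let w (n : nat) : R := (u n)%:R^-1.

Lemma inv_u_ge0 n : 0 <= w n. Proof. by rewrite invr_ge0. Qed.

Lemma inv_u1 : w 1%N = 1. Proof. by rewrite /w u1 invr1. Qed.

(** From [uSS] and [u n < u n.+1], [u] at least doubles at each step; this geometric decay gives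
    convergence. *)
Lemma inv_u_halves n : (0 < n)%N -> 2 * w n.+1 <= w n.
Proof.
case: n => // n _; have un1 := @u_gt0 n.+1 isT; have un2 := @u_gt0 n.+2 isT.
rewrite /w ler_pdivrMr ?ltr0n // mulrC ler_pdivlMr ?ltr0n //.
by rewrite -natrM ler_nat; have := uSS n; have := u_lt n; lia.
Qed.

Lemma inv_u_nonincreasing n : (0 < n)%N -> w n.+1 <= w n.
Proof. by move=> /inv_u_halves; have := inv_u_ge0 n.+1; lra. Qed.

(** Subtracting [w n] lets the induction close by halving. Halving fails from 0 to 1, so [n = 1] is
    a second base case. *)
Lemma sum_inv_u_le2 n : \sum_(1 <= i < n.+1) w i <= 2 - w n.
Proof.
elim: n => [|[|n] IH]; first by rewrite big_geq // /w u0 invr0; lra.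
  by rewrite big_nat1 inv_u1; lra.
by rewrite big_nat_recr //=; have := @inv_u_halves n.+1 isT; lra.
Qed.

Lemma sum_inv_u_nondecreasing :
  nondecreasing_seq (fun N => \sum_(1 <= n < N) w n).
Proof.
apply/nondecreasing_seqP => -[|n]; first by rewrite !big_geq.
by rewrite [leRHS]big_nat_recr //= lerDl inv_u_ge0.
Qed.

Lemma is_cvg_sum_inv_u : cvgn (fun N => \sum_(1 <= n < N) w n).
Proof.
apply: nondecreasing_is_cvgn; first exact: sum_inv_u_nondecreasing.
exists 2 => _ [[|n] _ <-]; first by rewrite big_geq.
by have := sum_inv_u_le2 n; have := inv_u_ge0 n; lra.
Qed.

(** By uniqueness, any representation computes [f], not just the chosen [digits a]. *)
Lemma f_repr a d m : is_repr a d -> (forall i, m < i -> d i = 0)%N ->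
  f R a = \sum_(1 <= i < m.+1) (d i)%:R * w i.
Proof.
move=> ad dm; rewrite /f (repr_unique (digitsP a) ad).
apply/cvg_lim => //; apply: cvg_near_cst; near=> n.
have mn : (m < n)%N by near: n; exists m.+1.
rewrite (@big_cat_nat _ _ _ m.+1) //= [X in _ + X]big_nat.
by rewrite [X in _ + X]big1 ?addr0 // => i /andP[mi _]; rewrite dm ?mul0r.
Unshelve. all: by end_near. Qed.

Lemma f_le a : f R a <= 1 + limn (fun N => \sum_(1 <= n < N) w n).
Proof.
have ad := digitsP a; have [_ d2 [m [dm _]] dV] := ad.
rewrite (@f_repr _ _ m ad); last by move=> i /ltnW; exact: dm.
apply: le_trans (sum_digits_le _ w _ m inv_u_ge0 inv_u_nonincreasing d2 dV) _.
rewrite inv_u1 lerD2l.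
exact: (nondecreasing_cvgn_le sum_inv_u_nondecreasing is_cvg_sum_inv_u).
Qed.

(* Witness: the digits 2,1,...,1 of length [n + 1]. *)
Lemma f_attains n : exists a, f R a = 1 + \sum_(1 <= i < n.+2) w i.
Proof.
pose d i := if i == 1%N then 2%N else (0 < i <= n.+1)%N : nat.
have dn i : (n.+1 < i)%N -> d i = 0%N by rewrite /d; case: eqP; lia.
have rd : is_repr (\sum_(1 <= i < n.+2) d i * u i)%N d.
  split=> //; first by move=> i; rewrite /d; case: ifP => // _; case: (_ && _).
    by exists n.+2.
  (* With a single digit 2, the separation condition is vacuous. *)
  have d2 i : d i = 2%N -> i = 1%N.
    by rewrite /d; case: eqP => // _; case: (_ && _).
  by move=> i j ij /d2 i1 /d2 j1; rewrite i1 j1 in ij.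
exists (\sum_(1 <= i < n.+2) d i * u i)%N; rewrite (f_repr _ _ _ rd dn).
rewrite ![\sum_(1 <= i < n.+2) _]big_ltn // inv_u1 /d eqxx mulr1 addrA.
congr (_ + _); apply: eq_big_nat => i /andP[i1 lein].
have -> : (i == 1%N) = false by lia.
have -> : (0 < i <= n.+1)%N = true by lia.
by rewrite mul1r.
Qed.

End ReciprocalSeries.

Theorem theorem23 (R : realType) :
  [/\ cvgn (fun N : nat => \sum_(1 <= n < N) (fib (2 * n))%:R^-1 : R),
      has_sup (range (f R))
    & sup (range (f R)) =
        1 + limn (fun N : nat => \sum_(1 <= n < N) (fib (2 * n))%:R^-1 : R)].
Proof.
have cv := is_cvg_sum_inv_u R.
have ub : ubound (range (f R))
    (1 + limn (fun N : nat => \sum_(1 <= n < N) (fib (2 * n))%:R^-1 : R)).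
  by move=> _ [a _ <-]; exact: f_le.
have hs : has_sup (range (f R)).
  by split; [exists (f R 0), 0%N|eexists; exact: ub].
split=> //; apply/eqP; rewrite eq_le; apply/andP; split.
  by apply: ge_sup => //; case: hs.
(* For the lower bound, each partial sum with [N >= 2] is [f a - 1] for some [a], hence at most the
   supremum minus 1. *)
rewrite addrC -lerBrDr; apply: limr_le => //; near=> N.
have N1 : (1 < N)%N by near: N; exists 2%N.
have [a fa] := f_attains R N.-2; rewrite (_ : N.-2.+2 = N) in fa; last by lia.
rewrite lerBrDr addrC -[leLHS]fa; apply: sup_upper_bound => //.
Unshelve. all: by end_near. Qed.
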